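(* If $G$ is a connected cograph and $v$ is a vertex of $G$, then $M_{G,v}\geq M_G$, with equality if and only if $G\cong K_1$.
   Context: All graphs are finite and simple with at least one vertex. A graph is a cograph if it contains no induced path on $4$ vertices. For a graph $G$ of order $n$ (number of vertices), let $a_k(G)$ be the number of $k$-element vertex subsets of $G$ that induce a connected subgraph (single vertices count as connected), and for a vertex $v$ let $a_k(G;v)$ be the number of those containing $v$. Let $\Phi_G(x)=\sum_{k=1}^n a_k(G)x^k$ and $\Phi_{G,v}(x)=\sum_{k=1}^n a_k(G;v)x^k$. The global mean is $M_G=\Phi_G'(1)/\Phi_G(1)$, and the local mean at $v$ is $M_{G,v}=\Phi_{G,v}'(1)/\Phi_{G,v}(1)$. *)

(* Defs.v *)
From HB Require Import structures.
From mathcomp Require Import all_boot all_order all_algebra.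
Set Implicit Arguments.
Unset Strict Implicit.
Unset Printing Implicit Defensive.
Import GRing.Theory.
Local Open Scope ring_scope.

Record sgraph := SGraph {
  vertex :> finType;
  adj : rel vertex;
  adj_sym : symmetric adj;
  adj_irrefl : irreflexive adj
}.

Definition iso (G H : sgraph) : Prop :=
  exists2 f : G -> H, bijective f & forall x y, adj (f x) (f y) = adj x y.

Section Induced.
Variables (G : sgraph) (A : {set G}).

Definition induced_adj : rel {x : G | x \in A} :=
  [rel x y | adj (val x) (val y)].

Fact induced_adj_sym : symmetric induced_adj.
Proof. by move=> x y; exact: adj_sym. Qed.

Fact induced_adj_irrefl : irreflexive induced_adj.
Proof. by move=> x; exact: adj_irrefl. Qed.

Definition induced : sgraph := SGraph induced_adj_sym induced_adj_irrefl.

End Induced.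

Section PathGraph.
Variable n : nat.

Definition path_adj : rel 'I_n :=
  [rel i j : 'I_n | (i.+1 == j :> nat) || (j.+1 == i :> nat)].

Fact path_adj_sym : symmetric path_adj.
Proof. by move=> i j; rewrite /path_adj /= orbC. Qed.

Fact path_adj_irrefl : irreflexive path_adj.
Proof. by move=> i; rewrite /path_adj /= orbb gtn_eqF. Qed.

Definition path_graph : sgraph := SGraph path_adj_sym path_adj_irrefl.

End PathGraph.

Section CompleteGraph.
Variable n : nat.

Definition complete_adj : rel 'I_n := [rel i j : 'I_n | i != j].

Fact complete_adj_sym : symmetric complete_adj.
Proof. by move=> i j; rewrite /complete_adj /= eq_sym. Qed.

Fact complete_adj_irrefl : irreflexive complete_adj.
Proof. by move=> i; rewrite /complete_adj /= eqxx. Qed.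

Definition complete_graph : sgraph :=
  SGraph complete_adj_sym complete_adj_irrefl.

End CompleteGraph.

Definition cograph (G : sgraph) : Prop :=
  forall A : {set G}, ~ iso (induced A) (path_graph 4).

(* The graph without vertices is not connected. *)
Definition connected (G : sgraph) : bool :=
  (0 < #|{: G}|)%N && [forall x : G, forall y : G, connect (@adj G) x y].

Definition num_conn (G : sgraph) (k : nat) : nat :=
  #|[set A : {set G} | (#|A| == k) && connected (induced A)]|.

Definition num_conn_at (G : sgraph) (v : G) (k : nat) : nat :=
  #|[set A : {set G} | [&& #|A| == k, connected (induced A) & v \in A]]|.

Definition Phi (G : sgraph) : {poly rat} :=
  \sum_(1 <= k < #|{: G}|.+1) (num_conn G k)%:R *: 'X^k.

Definition Phi_at (G : sgraph) (v : G) : {poly rat} :=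
  \sum_(1 <= k < #|{: G}|.+1) (num_conn_at v k)%:R *: 'X^k.

(* The denominator is positive when G has a vertex, and below always, since
   singletons count as connected. All values are rational, so rat suffices. *)
Definition global_mean (G : sgraph) : rat :=
  (Phi G)^`().[1] / (Phi G).[1].

Definition local_mean (G : sgraph) (v : G) : rat :=
  (Phi_at v)^`().[1] / (Phi_at v).[1].

(* Main.v *)
(** Let n be the order of G. The mean over the connected sets containing v is at
    least (n + 1) / 2, while for n > 1 the mean over those avoiding v, i.e. over
    the connected sets of the cograph G - v, is strictly below (n + 1) / 2; the
    global mean is a mediant of the two. Both bounds are proved by induction on
    the decomposition of a P4-free graph as a disjoint union or a join. In a
    disjoint union every connected set lies in one side; in a join a
    nonempty set is disconnected only if it lies in one side and is disconnected
    there, so all sums reduce to sums over all subsets. For the local bound the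
    induction runs on a form weakened by half the number of disconnected sets
    containing v, since the bound itself fails for disconnected graphs. *)

Require Import Defs.
From mathcomp Require Import all_boot all_order all_algebra.
From mathcomp Require Import ring lra.
Import Order.TTheory GRing.Theory Num.Theory.
Set Implicit Arguments.
Unset Strict Implicit.
Unset Printing Implicit Defensive.
Local Open Scope ring_scope.

(** * Sums over the subsets of a finite set *)

Section SubsetSums.
Variable T : finType.
Implicit Types (S A : {set T}) (v : T) (P : pred {set T}) (w : {set T} -> rat).

Definition subset_sum P w S : rat := \sum_(A : {set T} | (A \subset S) && P A) w A.

Lemma subset_sum1 S : subset_sum xpredT (fun=> 1) S = 2 ^+ #|S|.
Proof.
rewrite /subset_sum sumr_const -natrX -card_powerset; congr (_ *+ _).
by apply: eq_card => A; rewrite powersetE unfold_in andbT.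
Qed.

(* Complementation in S pairs the subsets of sizes k and #|S| - k. *)
Lemma subset_sum_card S :
  subset_sum xpredT (fun A => #|A|%:R) S *+ 2 = #|S|%:R * 2 ^+ #|S|.
Proof.
rewrite mulr2n {2}/subset_sum.
rewrite (reindex_onto (fun A => S :\: A) (fun A => S :\: A)) /=; last first.
  by move=> A /andP[sAS _]; rewrite setDDr setDv set0U; apply/setIidPr.
rewrite (eq_bigl (fun A : {set T} => (A \subset S) && true)) => [|A]; last first.
  rewrite subsetDl setDDr setDv set0U !andbT.
  exact: (sameP eqP setIidPr).
rewrite -big_split /= -subset_sum1 /subset_sum mulr_sumr.
apply: eq_bigr => A /andP[sAS _]; rewrite mulr1 -natrD.
by rewrite addnC -(cardsID A S) (setIidPr sAS) addnC.
Qed.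

(** The condition on [v] sits in the weight rather than in [P], so that the union and join
    recurrences for [subset_sum conn] apply to local sums as well; counts then carry the weight
    [(v \in A)%:R * 1]. *)
Lemma subset_sum_at P w v S : v \in S ->
  subset_sum P (fun A => (v \in A)%:R * w A) S =
  subset_sum P w S - subset_sum P w (S :\ v).
Proof.
move=> vS; apply/eqP; rewrite eq_sym subr_eq; apply/eqP.
rewrite /subset_sum [LHS](bigID (fun A => v \in A)) /=; congr (_ + _).
  rewrite big_mkcondr /=; apply: eq_bigr => A _.
  by case: (v \in A); rewrite ?mul1r ?mul0r.
by apply: eq_bigl => A; rewrite subsetD1 andbAC.
Qed.

Lemma subset_sum_at_notin P w v S : v \notin S ->
  subset_sum P (fun A => (v \in A)%:R * w A) S = 0.
Proof.
move=> vS; rewrite /subset_sum big1 // => A /andP[/subsetP sAS _].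
by rewrite (contraNF (sAS v) vS) mul0r.
Qed.

Lemma subset_sum1_at v S : v \in S ->
  subset_sum xpredT (fun A => (v \in A)%:R * 1) S *+ 2 = 2 ^+ #|S|.
Proof.
move=> vS; rewrite subset_sum_at // !subset_sum1 (cardsD1 v S) vS add1n.
by rewrite exprS; ring.
Qed.

Lemma subset_sum_card_at v S : v \in S ->
  subset_sum xpredT (fun A => (v \in A)%:R * #|A|%:R) S *+ 4 =
  (#|S|%:R + 1) * 2 ^+ #|S|.
Proof.
move=> vS; rewrite subset_sum_at //.
rewrite (mulrnA _ 2 2) mulrnBl !subset_sum_card (cardsD1 v S) vS add1n exprS.
by rewrite -natr1; ring.
Qed.

Lemma subset_sum_le P w S : (forall A, 0 <= w A) ->
  subset_sum P w S <= subset_sum xpredT w S.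
Proof.
move=> w0; rewrite /subset_sum big_mkcondr [leRHS]big_mkcondr /=.
by apply: ler_sum => A _; case: (P A).
Qed.

Lemma subset_sum_ge0 P w S : (forall A, 0 <= w A) -> 0 <= subset_sum P w S.
Proof. by move=> w0; apply: sumr_ge0. Qed.

End SubsetSums.

(** * Decomposition of P4-free graphs into unions and joins *)

Section Split.
Variable T : finType.
Implicit Types (e f : rel T) (S X : {set T}).

(** With adjacency and non-adjacency as two relations, complementation just exchanges them. In a
    simple graph the six conditions force the four vertices to be distinct. *)
Definition p4_free e f S := forall a b c d,
  [/\ a \in S, b \in S, c \in S & d \in S] ->
  [/\ e a b, e b c & e c d] -> [/\ f a c, f b d & f a d] -> False.

(* With [e] the adjacency relation, [S] is the join of [X] and [S :\: X]; with [e]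
   its negation, their disjoint union. *)
Definition splits e S X :=
  [/\ X != set0, X \proper S & {in X & S :\: X, forall x y, e x y}].

(* The complement of the path a b c d is the path b d a c. *)
Lemma p4_free_compl e f S : symmetric e -> symmetric f ->
  p4_free e f S -> p4_free f e S.
Proof.
move=> se sf P a b c d [aS bS cS dS] [ab bc cd] [ac bd ad].
by apply: (P b d a c) => //; split; rewrite // ?[e d a]se ?[f b a]sf ?[f d c]sf.
Qed.

Lemma splits_compl e S X : symmetric e -> splits e S X -> splits e S (S :\: X).
Proof.
move=> se [X0 XS H]; have /properP[sXS [y yS yX]] := XS; split.
- by apply/set0Pn; exists y; rewrite inE yX.
- have /set0Pn[x xX] := X0; apply/properP; split; first exact: subsetDl.
  by exists x; [exact: (subsetP sXS) | rewrite inE xX].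
- move=> x z xSX; rewrite setDDr setDv set0U => /setIP[_ zX].
  by rewrite se; apply: H.
Qed.

(* For e = adjacency and f = non-adjacency: if v has a non-neighbour in X and
   S is not disconnected, then v has a neighbour z outside X and there is an edge
   u' u of X with u, but not u', adjacent to v; so z v u u' is an induced path. *)
Lemma splits_extend e f S X v : symmetric e -> symmetric f ->
    (forall x y, e x y || f x y) ->
    v \in S -> p4_free e f S -> splits f (S :\ v) X ->
  exists Y, splits e S Y \/ splits f S Y.
Proof.
move=> se sf tot vS P4.
have ntot x y : ~~ e x y -> f x y by have := tot x y; case: (e x y).
have [/forallP all_e|/forallPn[w]] :=
    boolP [forall x, (x \in S :\ v) ==> e v x].
  move=> [X0 /properP[sX [y yS yX]] _]; exists [set v]; left; split.
  - by apply/set0Pn; exists v; rewrite inE.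
  - apply/properP; split; first by rewrite sub1set.
    by exists y; move: yS; rewrite !inE => /andP[].
  - by move=> x z /set1P-> zS; apply: (implyP (all_e z)).
rewrite negb_imply => /andP[wS nvw].
(* Exchanging the two sides puts the non-neighbour [w] of [v] into [X]. *)
wlog wX : X / w \in X.
  move=> IH spX; have [|wX] := boolP (w \in X); first by move/IH; apply.
  by apply: (IH ((S :\ v) :\: X)); [rewrite inE wX | apply: splits_compl].
move=> spX; have [X0 /properP[sX [y yS yX]] fX] := spX.
have vX : v \notin X by apply/negP => /(subsetP sX); rewrite !inE eqxx.
pose N := [set x in X | ~~ e v x].
have wN : w \in N by rewrite inE wX.
have [/forall_inP fN|] :=
    boolP [forall x in N, [forall y in X :\: N, f x y]].
  (* No edge joins [N] to [X :\: N], to [v] or to the other side, so [N] splits off from the whole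
     of [S]. *)
  exists N; right; split.
  - by apply/set0Pn; exists w.
  - apply/properP; split; last by exists v; rewrite // inE (negPf vX).
    apply/subsetP => x; rewrite inE => /andP[/(subsetP sX) + _].
    by rewrite !inE => /andP[].
  - move=> x z xN; rewrite inE => /andP[zN zS].
    have /andP[xX nvx] : (x \in X) && ~~ e v x by rewrite inE in xN.
    have [->|zv] := eqVneq z v; first by rewrite sf; exact: ntot.
    have [zX|zX] := boolP (z \in X).
      by apply: (forall_inP (fN x xN)); rewrite inE zN.
    by apply: fX; rewrite // !inE zX zv.
rewrite negb_forall_in => /exists_inP[u' u'N]; rewrite negb_forall_in.
move=> /exists_inP[u uXN nfu].
have /andP[u'X nvu'] : (u' \in X) && ~~ e v u' by rewrite inE in u'N.
have [uN uX] : u \notin N /\ u \in X by move: uXN; rewrite inE => /andP[].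
have vu : e v u by move: uN; rewrite inE uX negbK.
have u'u : e u' u by have := tot u' u; rewrite (negPf nfu) orbF.
have XS x : x \in X -> x \in S by move/(subsetP sX); rewrite inE => /andP[].
have [/exists_inP[z zY vz]|noz] :=
    boolP [exists z in (S :\ v) :\: X, e v z].
  have zS : z \in S by move: zY; rewrite !inE => /and3P[].
  exfalso; apply: (P4 z v u u').
  - by split=> //; exact: XS.
  - by split; rewrite // se.
  - by split; rewrite ?[f z _]sf; [exact: fX | exact: ntot | exact: fX].
(* Here [v] has no neighbour beyond [X], so the far side splits off from [S]. *)
exists ((S :\ v) :\: X); right.
have [Y0 /properP[sY _] fY] := splits_compl sf spX; split=> //.
  apply/properP; split; first by apply: (subset_trans sY); rewrite subD1set.
  by exists v; rewrite // !inE eqxx andbF.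
move=> x z xY zY'; have [->|zv] := eqVneq z v.
  rewrite sf; apply: ntot.
  by apply: contra noz => vx; apply/exists_inP; exists x.
apply: fY => //; move: zY'; rewrite !inE zv /= => /andP[+ zS].
by rewrite zS andbT negbK => ->.
Qed.

(** Seinsche's theorem: a P4-free graph with at least two vertices is disconnected or has a
    disconnected complement. The induction removes a vertex, splits the rest, and puts the vertex
    back by [splits_extend]. *)
Lemma p4_free_splits e f S : symmetric e -> symmetric f ->
    (forall x y, e x y || f x y) ->
    p4_free e f S -> (1 < #|S|)%N ->
  exists X, splits e S X \/ splits f S X.
Proof.
move=> se sf tot; have [n] := ubnP #|S|.
elim: n => // n IHn in S *; rewrite ltnS => Sn P4 S1.
have /card_gt0P[v vS] := ltnW S1.
have cS := cardsD1 v S; rewrite vS add1n in cS.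
have [S'1|S'1] := leqP #|S :\ v| 1.
  have /cards1P[w Sw] : #|S :\ v| == 1%N.
    by rewrite eqn_leq S'1 -ltnS -cS.
  have wS : w \in S :\ v by rewrite Sw set11.
  move: wS; rewrite !inE => /andP[wv wS].
  have pr : [set v] \proper S.
    by apply/properP; split; [rewrite sub1set | exists w; rewrite // inE].
  have v0 : [set v] != set0 by apply/set0Pn; exists v; rewrite inE.
  case/orP: (tot v w) => vw; exists [set v];
    by [left; split=> // x y /set1P->; rewrite Sw => /set1P->
       |right; split=> // x y /set1P->; rewrite Sw => /set1P->].
have P4' : p4_free e f (S :\ v).
  move=> a b c d [] /setD1P[_ aS] /setD1P[_ bS] /setD1P[_ cS'] /setD1P[_ dS].
  exact: P4.
have [|X [spX|spX]] := IHn (S :\ v) _ P4' S'1; first by rewrite -cS.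
  (* A join is a disjoint union in the complement, which is P4-free too. *)
  have [|Y [spY|spY]] := splits_extend sf se _ vS (p4_free_compl se sf P4) spX.
  - by move=> x y; rewrite orbC.
  - by exists Y; right.
  - by exists Y; left.
exact: splits_extend spX.
Qed.

End Split.

(** * Connected sets in disjoint unions and joins *)

Section Connected.
Variables (T : finType) (e : rel T).
Hypothesis e_sym : symmetric e.
Implicit Types (S X A : {set T}) (w : {set T} -> rat).

Definition nonadj : rel T := [rel x y | ~~ e x y].

(* Connectedness by cuts, which avoids restricting [connect] to subsets. *)
Definition conn A :=
  (A != set0) && [forall X : {set T}, (X != set0) && (X \proper A) ==>
    [exists x in X, [exists y in A :\: X, e x y]]].

Lemma nonadj_sym : symmetric nonadj.
Proof. by move=> x y; rewrite /nonadj /= e_sym. Qed.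

Lemma connP A :
  reflect (A != set0 /\ forall X, ~ splits nonadj A X) (conn A).
Proof.
apply: (iffP andP) => -[A0].
  move=> /forallP cA; split=> // X [X0 XA nX].
  have := cA X; rewrite X0 XA => /exists_inP[x xX /exists_inP[y yX]].
  by apply/negP; exact: nX.
move=> cA; split=> //; apply/forallP => X; apply/implyP => /andP[X0 XA].
apply: contraT; rewrite negb_exists_in => /forall_inP nX.
exfalso; apply: (cA X); split=> // x y xX yX.
by apply: contra (nX x xX) => exy; apply/exists_inP; exists y.
Qed.

Lemma conn_set1 x : conn [set x].
Proof.
apply/connP; split=> [|X [/set0Pn[y yX] /properP[/subsetP sX [z zx]] +] _].
  by apply/set0Pn; exists x; rewrite inE.
by move: zx (sX y yX) => /set1P-> /set1P <-; rewrite yX.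
Qed.

Lemma conn_sub A S X : splits nonadj S X -> A \subset S -> conn A ->
  (A \subset X) || (A \subset S :\: X).
Proof.
move=> [_ _ nX] sAS /connP[_ cA]; apply/norP => -[/subsetPn[y yA yX]].
rewrite subsetD sAS /= -setI_eq0 => AX0; apply: (cA (A :&: X)); split=> //.
  apply/properP; split; first exact: subsetIl.
  by exists y; rewrite // inE (negPf yX) andbF.
move=> x z; rewrite !inE => /andP[xA xX] /andP[+ zA].
rewrite zA /= => zX; apply: nX; rewrite // inE zX; exact: (subsetP sAS).
Qed.

(** All edges between the nonempty parts of [A] inside and outside [X] are present. A set [Y] with
    no edge to the rest of [A] therefore contains all of [A] or none of it. *)
Lemma conn_meet A S X : splits e S X -> A \subset S ->
  ~~ (A \subset X) -> ~~ (A \subset S :\: X) -> conn A.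
Proof.
move=> [_ _ eX] sAS /subsetPn[y yA yX].
rewrite subsetD sAS -setI_eq0 => /set0Pn[x /setIP[xA xX]].
apply/connP; split=> [|Y [/set0Pn[p pY] /properP[/subsetP sY [q qA qY]] nY]].
  by apply/set0Pn; exists x.
have cross a b : a \in A -> b \in A -> a \in X -> b \notin X ->
    (a \in Y) = (b \in Y).
  move=> aA bA aX bX.
  have eab : e a b by apply: eX; rewrite // inE bX (subsetP sAS).
  have [aY|aY] := boolP (a \in Y); have [bY|bY] := boolP (b \in Y) => //.
    by have := nY a b aY; rewrite inE bY bA /nonadj /= eab; move/(_ isT).
  by have := nY b a bY; rewrite inE aY aA /nonadj /= e_sym eab; move/(_ isT).
have const a : a \in A -> (a \in Y) = (x \in Y).
  move=> aA; have [aX|aX] := boolP (a \in X).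
    by rewrite (cross a y) // (cross x y).
  by rewrite (cross x a).
by move: qY; rewrite const // -(const p) ?pY // sY.
Qed.

Lemma conn_sum_union w S X : splits nonadj S X ->
  subset_sum conn w S = subset_sum conn w X + subset_sum conn w (S :\: X).
Proof.
move=> spX; have [_ /proper_sub sX _] := spX.
rewrite /subset_sum big_mkcond [X in _ = X + _]big_mkcond.
rewrite [X in _ = _ + X]big_mkcond -big_split /=; apply: eq_bigr => A _.
have [cA|] := boolP (conn A); last by rewrite !andbF addr0.
have /connP[/set0Pn[x xA] _] := cA; rewrite !andbT.
have [sAX|nAX] := boolP (A \subset X).
  rewrite (subset_trans sAX sX) ifN ?addr0 //.
  by apply/subsetPn; exists x => //; rewrite inE (subsetP sAX).
rewrite add0r; have [sAS|nAS] := boolP (A \subset S).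
  by have := conn_sub spX sAS cA; rewrite (negPf nAX) /= => ->.
by rewrite ifN //; apply: contra nAS => /subset_trans->; rewrite // subsetDl.
Qed.

(** The nonempty disconnected subsets of [S] are those of the two sides. In the differences between
    all and connected subsets, the empty set counts once for [S] but twice for the sides; [w set0]
    balances this. *)
Lemma conn_sum_join w S X : splits e S X ->
  subset_sum conn w S + subset_sum xpredT w X + subset_sum xpredT w (S :\: X)
  = subset_sum xpredT w S + w set0
    + subset_sum conn w X + subset_sum conn w (S :\: X).
Proof.
move=> spX; have [_ /proper_sub sX _] := spX.
(* Written as a sum over all sets, this term lets the identity be checked set by set. *)
have -> : w set0 = \sum_(A : {set T}) if A == set0 then w A else 0.
  by rewrite -big_mkcond big_pred1_eq.
rewrite /subset_sum ![\sum_(A | _ && _) _]big_mkcond -!big_split /=.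
apply: eq_bigr => A _; rewrite !andbT.
have [->|/set0Pn[x xA]] := eqVneq A set0.
  by rewrite !sub0set /conn eqxx /= add0r !addr0.
have [sAX|nAX] := boolP (A \subset X).
  rewrite (subset_trans sAX sX) (_ : A \subset S :\: X = false) /=; first by ring.
  by apply/negP => /subsetP /(_ x xA); rewrite inE (subsetP sAX).
have [sAD|nAD] := boolP (A \subset S :\: X).
  by rewrite (subset_trans sAD (subsetDl _ _)) /=; ring.
rewrite /= !addr0; have [sAS|//] := boolP (A \subset S).
by rewrite (conn_meet spX).
Qed.

Lemma conn_sum_set1 w x : subset_sum conn w [set x] = w [set x].
Proof.
rewrite /subset_sum (big_pred1 [set x]) // => A; rewrite subset1 /=.
have [->|_] /= := eqVneq A [set x]; first exact: conn_set1.
by apply/negP => /andP[/eqP->]; rewrite /conn eqxx.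
Qed.

Lemma p4_free_ind (P : {set T} -> Prop) :
    (forall x, P [set x]) ->
    (forall S X, splits nonadj S X -> P X -> P (S :\: X) -> P S) ->
    (forall S X, splits e S X -> P X -> P (S :\: X) -> P S) ->
  forall S, S != set0 -> p4_free e nonadj S -> P S.
Proof.
move=> P1 Pu Pj S; have [n] := ubnP #|S|.
elim: n => // n IHn in S *; rewrite ltnS => Sn S0 P4.
have sub_IH X : X != set0 -> X \proper S -> P X.
  move=> X0 XS; apply: IHn => //; first exact: leq_trans (proper_card XS) Sn.
  move=> a b c d [aX bX cX dX].
  by apply: P4; split; exact: (subsetP (proper_sub XS)).
have [S1|S1] := leqP #|S| 1.
  have /cards1P[x ->] : #|S| == 1%N by rewrite eqn_leq S1 card_gt0.
  exact: P1.
have tot x y : e x y || nonadj x y by rewrite /nonadj /= orbN.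
have [X [spX|spX]] := p4_free_splits e_sym nonadj_sym tot P4 S1.
  have [X0 XS _] := spX; have [Y0 YS _] := splits_compl e_sym spX.
  by apply: (Pj S X) => //; exact: sub_IH.
have [X0 XS _] := spX; have [Y0 YS _] := splits_compl nonadj_sym spX.
by apply: (Pu S X) => //; exact: sub_IH.
Qed.

(** * Upper bound for the mean over all connected sets *)

Lemma natr_rat_ge0 (n : nat) : 0 <= n%:R :> rat.
Proof. exact: ler0n. Qed.

Lemma pow2_gt (n : nat) : n%:R + 1 <= 2 ^+ n :> rat.
Proof. by rewrite natr1 -natrX ler_nat ltn_expl. Qed.

Lemma splits_card f S X : splits f S X -> #|S| = (#|X| + #|S :\: X|)%N.
Proof. by move=> [_ /proper_sub sX _]; rewrite -(cardsID X S) (setIidPr sX). Qed.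

Let ge0_1 (A : {set T}) : 0 <= 1 :> rat.
Proof. exact: ler01. Qed.

(** The constant is chosen for [S] = G - v, where [#|S| + 2] is the order of G plus one.
    Connectedness of [S] is not assumed, as G - v may be disconnected. *)
Lemma conn_card_bound S : S != set0 -> p4_free e nonadj S ->
  2 * subset_sum conn (fun A => #|A|%:R) S
  < (#|S|%:R + 2) * subset_sum conn (fun=> 1) S.
Proof.
move: S; apply: p4_free_ind.
- by move=> x; rewrite !conn_sum_set1 cards1; lra.
- move=> S X spX; rewrite !(conn_sum_union _ spX) (splits_card spX) natrD.
  have := subset_sum_ge0 conn X ge0_1.
  have := subset_sum_ge0 conn (S :\: X) ge0_1.
  move: (subset_sum _ _ X) (subset_sum _ _ (S :\: X)) => n1 n2.
  move: (subset_sum _ _ X) (subset_sum _ _ (S :\: X)) => m1 m2.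
  have := natr_rat_ge0 #|X|; have := natr_rat_ge0 #|S :\: X|.
  by move: (#|X|%:R) (#|S :\: X|%:R) => a b; nra.
move=> S X spX.
have := conn_sum_join (fun A => #|A|%:R) spX; have := conn_sum_join (fun=> 1) spX.
have := subset_sum_card S; have := subset_sum_card X.
have := subset_sum_card (S :\: X).
rewrite !subset_sum1 cards0 (splits_card spX) natrD exprD.
have n1ge0 := subset_sum_ge0 conn X ge0_1.
have n2ge0 := subset_sum_ge0 conn (S :\: X) ge0_1.
have p_gt := pow2_gt #|X|; have q_gt := pow2_gt #|S :\: X|.
have a_ge0 := natr_rat_ge0 #|X|; have b_ge0 := natr_rat_ge0 #|S :\: X|.
move: #|X|%:R #|S :\: X|%:R (2 ^+ #|X|) (2 ^+ #|S :\: X|) a_ge0 b_ge0 p_gt q_gt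
  (subset_sum conn _ X) (subset_sum conn _ (S :\: X)) n1ge0 n2ge0 => 
  a b p q a_ge0 b_ge0 p_gt q_gt n1 n2 n1_ge0 n2_ge0 M2 M1 M nS mS h1 h2.
(* Right side minus left side equals the sum of the four products [h3] to [h6] plus the
   corresponding differences for the two sides of the join, which are positive by induction. *)
have h3 : 0 <= (p - a - 1) * (q - 1) by apply: mulr_ge0; lra.
have h4 : 0 <= (q - b - 1) * (p - 1) by apply: mulr_ge0; lra.
have h5 : 0 <= b * n1 by apply: mulr_ge0.
have h6 : 0 <= a * n2 by apply: mulr_ge0.
have -> : subset_sum conn (fun=> 1) S = p * q + 1 + n1 + n2 - p - q.
  by move: nS; lra.
move: mS; lra.
Qed.

(** * Lower bound for the mean at a vertex *)

Lemma conn_at_le_pow2 v S : v \in S ->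
  2 * subset_sum conn (fun A => (v \in A)%:R * 1) S <= 2 ^+ #|S|.
Proof.
move=> vS; rewrite -(subset_sum1_at vS) mulr_natl ler_pMn2r //.
by apply: subset_sum_le => A; rewrite mulr1 ler0n.
Qed.

(* Equivalently, the sum of 2 #|A| - #|S| - 1 over the connected A containing v
   is at least minus the number of disconnected ones, there being 2 ^ #|S| / 2
   subsets of S containing v. *)
Definition conn_at_bound v S : Prop :=
  (#|S|%:R + 2) * subset_sum conn (fun A => (v \in A)%:R * 1) S <=
  2 * subset_sum conn (fun A => (v \in A)%:R * #|A|%:R) S + 2 ^+ #|S| / 2.

(** The connected sets at [v] are unchanged. With b, p, q as in the proof and n their number, the
    left side grows by b n, at most b p / 2, and the right side by p (q - 1) / 2, where q is at
    least b + 1. *)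
Lemma conn_at_bound_union v S X : splits nonadj S X -> v \in X ->
  conn_at_bound v X -> conn_at_bound v S.
Proof.
move=> spX vX; rewrite /conn_at_bound.
have vD : v \notin S :\: X by rewrite inE vX.
rewrite !(conn_sum_union _ spX) ![subset_sum _ _ (S :\: X)]subset_sum_at_notin //.
rewrite (splits_card spX) natrD exprD !addr0.
have := conn_at_le_pow2 vX.
have := pow2_gt #|S :\: X|; have := natr_rat_ge0 #|S :\: X|.
have := pow2_gt #|X|; have := natr_rat_ge0 #|X|.
move: #|X|%:R #|S :\: X|%:R (2 ^+ #|X|) (2 ^+ #|S :\: X|)
  (subset_sum _ _ _) (subset_sum _ _ _) => a b p q m n a_ge0 p_gt b_ge0 q_gt np h.
have h1 : 0 <= b * (p - 2 * n) by apply: mulr_ge0; lra.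
have h2 : 0 <= p * (q - b - 1) by apply: mulr_ge0; lra.
lra.
Qed.

(** Over all subsets of [S] containing [v], the terms 2 #|A| - #|S| - 1 sum to zero. The
    disconnected ones lie in [X]; let d be their number. By the bound on [X], their terms 2 #|A| -
    #|X| - 1 sum to at most d, so the connected sum is at least (b - 1) d, where b = [#|S :\: X|] is
    at least 1. *)
Lemma conn_at_join_strong v S X : splits e S X -> v \in X -> conn_at_bound v X ->
  (#|S|%:R + 1) * subset_sum conn (fun A => (v \in A)%:R * 1) S <=
  2 * subset_sum conn (fun A => (v \in A)%:R * #|A|%:R) S.
Proof.
move=> spX vX; rewrite /conn_at_bound.
have vD : v \notin S :\: X by rewrite inE vX.
have vS : v \in S by have [_ /proper_sub/subsetP->] := spX.
have b_gt0 : 1 <= #|S :\: X|%:R :> rat.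
  have [_ /properP[_ [y yS yX]] _] := spX.
  by rewrite (ler_nat _ 1); apply/card_gt0P; exists y; rewrite inE yX.
have := conn_sum_join (fun A => (v \in A)%:R * #|A|%:R) spX.
have := conn_sum_join (fun A => (v \in A)%:R * 1) spX.
have := subset_sum1_at vS; have := subset_sum1_at vX.
have := subset_sum_card_at vS; have := subset_sum_card_at vX.
rewrite ![subset_sum _ _ (S :\: X)]subset_sum_at_notin // !in_set0 !mul0r.
rewrite (splits_card spX) natrD exprD !addr0.
have := conn_at_le_pow2 vX.
move: #|X|%:R #|S :\: X|%:R (2 ^+ #|X|) (2 ^+ #|S :\: X|) b_gt0
  (subset_sum conn _ X) (subset_sum conn _ X) => 
  a b p q b_gt0 m n np MX MS NX NS hn hm h.
(* The factor [p - 2 * n] is twice the number of disconnected subsets of [X] containing [v]. *)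
have h1 : 0 <= (b - 1) * (p - 2 * n) by apply: mulr_ge0; lra.
have -> : subset_sum conn (fun A => (v \in A)%:R * 1) S = p * q / 2 - p / 2 + n.
  by move: hn NX NS; lra.
lra.
Qed.

Lemma conn_at_bound_join v S X : splits e S X -> v \in X ->
  conn_at_bound v X -> conn_at_bound v S.
Proof.
move=> spX vX h; have := conn_at_join_strong spX vX h; rewrite /conn_at_bound.
have vS : v \in S by have [_ /proper_sub/subsetP->] := spX.
by have := conn_at_le_pow2 vS; lra.
Qed.

Lemma splits_side f S X v : symmetric f -> splits f S X -> v \in S ->
  exists2 Y, splits f S Y & v \in Y /\ (Y = X \/ Y = S :\: X).
Proof.
move=> sf spX vS; have [vX|vX] := boolP (v \in X).
  by exists X => //; split; [|left].
exists (S :\: X); first exact: splits_compl.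
by rewrite inE vX; split; [|right].
Qed.

Lemma p4_free_conn_at_bound S : S != set0 -> p4_free e nonadj S ->
  {in S, forall v, conn_at_bound v S}.
Proof.
move: S; apply: p4_free_ind.
- move=> x v /set1P->; rewrite /conn_at_bound !conn_sum_set1 cards1 set11 /=; lra.
- move=> S X spX IH1 IH2 v /(splits_side nonadj_sym spX)[Y spY [vY YE]].
  by apply: (conn_at_bound_union spY vY); case: YE => YE; subst Y; auto.
- move=> S X spX IH1 IH2 v /(splits_side e_sym spX)[Y spY [vY YE]].
  by apply: (conn_at_bound_join spY vY); case: YE => YE; subst Y; auto.
Qed.

(** A connected [S] with two or more vertices must be a join. Its sides may be disconnected, and for
    them the weakened bound suffices. *)
Lemma conn_at_mean S v : (1 < #|S|)%N -> p4_free e nonadj S -> conn S ->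
  v \in S ->
  (#|S|%:R + 1) * subset_sum conn (fun A => (v \in A)%:R * 1) S <=
  2 * subset_sum conn (fun A => (v \in A)%:R * #|A|%:R) S.
Proof.
move=> S1 P4 /connP[_ cS] vS.
have tot x y : e x y || nonadj x y by rewrite /nonadj /= orbN.
have [X [spX|spX]] := p4_free_splits e_sym nonadj_sym tot P4 S1; last by case: (cS X).
have [Y spY [vY _]] := splits_side e_sym spX vS.
apply: (conn_at_join_strong spY vY).
have [_ /proper_sub/subsetP sY _] := spY.
apply: p4_free_conn_at_bound => //; first by apply/set0Pn; exists v.
by move=> a b c d [/sY ? /sY ? /sY ? /sY ?]; exact: P4.
Qed.

End Connected.

(** * The means of a connected cograph *)

Lemma mediant_lt (c n m n' m' : rat) :
  0 < n -> 0 <= n' -> 2 * m' < c * n' -> c * n <= 2 * m ->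
  (m + m') / (n + n') < m / n.
Proof.
move=> n_gt0 n'_ge0 lt' le.
rewrite ltr_pdivrMr ?ltr_pwDl // mulrAC ltr_pdivlMr //.
have h1 : 0 <= n' * (2 * m - c * n) by apply: mulr_ge0; lra.
have h2 : 0 < n * (c * n' - 2 * m') by apply: mulr_gt0; lra.
lra.
Qed.

Section SGraphs.
Variable G : sgraph.
Implicit Types A X : {set G}.

(** A side of a cut without crossing edges is closed under adjacency, so no path leaves it;
    conversely, the vertices reachable from [x] form such a side. *)
Lemma connected_induced A : connected (induced A) = conn (@adj G) A.
Proof.
apply/idP/idP => [/andP[A0 /forallP cA]|/connP[A0 cA]].
  apply/connP; split=> [|X [/set0Pn[x xX] /properP[sX [y yA yX]] nX]].
    by have /card_gt0P[x _] := A0; apply/set0Pn; exists (val x); exact: valP x.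
  have xA := subsetP sX x xX.
  pose x' : induced A := Sub x xA; pose y' : induced A := Sub y yA.
  have clX : closed (@adj (induced A)) [pred z | val z \in X].
    move=> a b ab; have {}ab : adj (val a) (val b) := ab; rewrite !inE /=.
    have [aA bA] := (valP a, valP b).
    have [aX|aX] := boolP (val a \in X); have [bX|bX] := boolP (val b \in X) => //.
      by have := nX (val a) (val b) aX; rewrite inE bX bA /nonadj /= ab => /(_ isT).
    have := nX (val b) (val a) bX; rewrite inE aX aA /nonadj /= adj_sym ab.
    by move=> /(_ isT).
  have /forallP/(_ y') xy := cA x'; have := closed_connect clX xy.
  by rewrite !inE /= xX (negPf yX).
apply/andP; split.
  by have /set0Pn[x xA] := A0; apply/card_gt0P; exists (Sub x xA).
apply/forallP => x; apply/forallP => y; apply: contraT => nxy.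
pose X : {set G} := [set val z | z in [pred z | connect (@adj (induced A)) x z]].
exfalso; apply: (cA X); split.
- by apply/set0Pn; exists (val x); apply: imset_f; rewrite inE connect0.
- apply/properP; split; first by apply/subsetP => _ /imsetP[z _ ->]; exact: valP z.
  exists (val y); first exact: valP y.
  by apply/imsetP => -[z + /val_inj yz]; rewrite -yz inE (negPf nxy).
- move=> _ q /imsetP[z xz ->] /setDP[qA qX]; apply: contra qX => zq.
  apply/imsetP; exists (Sub q qA); rewrite ?SubK // inE.
  by apply: connect_trans xz (connect1 _).
Qed.

Lemma cograph_p4_free : cograph G -> p4_free (@adj G) (nonadj (@adj G)) setT.
Proof.
move=> coG a b c d _ [ab bc cd] [nac nbd nad].
rewrite /nonadj /= in nac nbd nad.
pose h (i : 'I_4) : G := nth a [:: a; b; c; d] i.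
have hadj i j : adj (h i) (h j) = adj (i : path_graph 4) j.
  have [ba cb dc] : [/\ adj b a, adj c b & adj d c] by split; rewrite adj_sym.
  have [nca ndb nda] : [/\ ~~ adj c a, ~~ adj d b & ~~ adj d a].
    by split; rewrite adj_sym.
  case: i => -[|[|[|[|//]]]] ?; case: j => -[|[|[|[|//]]]] ?;
  by rewrite /h /= ?adj_irrefl //; apply/negbTE.
(* Distinct vertices of the path on four vertices have distinct neighbourhoods. *)
have h_inj : injective h.
  move=> i j hij; have r k : adj (i : path_graph 4) k = adj (j : path_graph 4) k.
    by rewrite -!hadj hij.
  move: (r (@Ordinal 4 0 isT)) (r (@Ordinal 4 1 isT)) (r (@Ordinal 4 2 isT))
    (r (@Ordinal 4 3 isT)).
  case: i {hij r} => -[|[|[|[|//]]]] ?; case: j => -[|[|[|[|//]]]] ? //= _ _ _ _;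
  exact: val_inj.
pose A := [set h i | i : 'I_4].
have hA i : h i \in A by exact: imset_f.
pose g (i : path_graph 4) : induced A := Sub (h i) (hA i).
have g_inj : injective g by move=> i j /(congr1 val) /h_inj.
have g_card : (#|induced A| <= #|path_graph 4|)%N.
  by rewrite card_sig card_imset.
have [g' gK g'K] := inj_card_bij g_inj g_card.
apply: (coG A); exists g'; first by exists g.
by move=> x y; rewrite -hadj -{2}(g'K x) -{2}(g'K y).
Qed.

(** Grouping by size loses no set, since the sizes start at 1 and [P] excludes the empty set. *)
Lemma sum_card_poly (P : pred {set G}) : (forall A, P A -> A != set0) ->
  \sum_(1 <= k < #|{: G}|.+1) #|[set A : {set G} | (#|A| == k) && P A]|%:R *: 'X^k
  = \sum_(A : {set G} | P A) 'X^#|A| :> {poly rat}.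
Proof.
move=> P0; transitivity (\sum_(1 <= k < #|{: G}|.+1)
    \sum_(A : {set G} | P A && (#|A| == k)) 'X^#|A| : {poly rat}).
  apply: eq_bigr => k _; rewrite (eq_bigr (fun=> 'X^k)) => [|A /andP[_ /eqP->]//].
  rewrite sumr_const scaler_nat; congr (_ *+ _).
  by apply: eq_card => A; rewrite inE unfold_in andbC.
rewrite (exchange_big_dep P) /=; last by move=> k A _ /andP[].
apply: eq_bigr => A PA; rewrite (eq_bigl (pred1 #|A|)) => [|k].
  by rewrite big_nat1_eq ltnS max_card card_gt0 P0.
by rewrite PA eq_sym.
Qed.

Lemma sum_card_poly_horner (P : pred {set G}) :
  (\sum_(A : {set G} | P A) 'X^#|A| : {poly rat}).[1] = \sum_(A : {set G} | P A) 1.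
Proof. by rewrite horner_sum; apply: eq_bigr => A _; rewrite hornerXn expr1n. Qed.

Lemma sum_card_poly_deriv (P : pred {set G}) :
  (\sum_(A : {set G} | P A) 'X^#|A| : {poly rat})^`().[1] = \sum_(A : {set G} | P A) #|A|%:R.
Proof.
rewrite raddf_sum horner_sum /=; apply: eq_bigr => A _.
by rewrite derivXn hornerMn hornerXn expr1n.
Qed.

Lemma global_meanE : global_mean G =
  subset_sum (conn (@adj G)) (fun A => #|A|%:R) setT
  / subset_sum (conn (@adj G)) (fun=> 1) setT.
Proof.
have PhiE : Phi G = \sum_(A : {set G} | conn (@adj G) A) 'X^#|A|.
  rewrite -sum_card_poly; last by move=> A /andP[].
  apply: eq_bigr => k _; rewrite /num_conn; congr (_%:R *: _); apply: eq_card => A.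
  by rewrite !inE connected_induced.
rewrite /global_mean PhiE sum_card_poly_deriv sum_card_poly_horner.
by congr (_ / _); apply: eq_bigl => A; rewrite subsetT.
Qed.

Lemma local_meanE (v : G) : local_mean v =
  subset_sum (conn (@adj G)) (fun A => (v \in A)%:R * #|A|%:R) setT
  / subset_sum (conn (@adj G)) (fun A => (v \in A)%:R * 1) setT.
Proof.
have PhiE : Phi_at v = \sum_(A : {set G} | conn (@adj G) A && (v \in A)) 'X^#|A|.
  rewrite -sum_card_poly; last by move=> A /andP[/andP[]].
  apply: eq_bigr => k _; rewrite /num_conn_at; congr (_%:R *: _).
  by apply: eq_card => A; rewrite !inE connected_induced.
rewrite /local_mean PhiE sum_card_poly_deriv sum_card_poly_horner.
congr (_ / _); rewrite big_mkcondr; apply: eq_big => A; rewrite ?subsetT //.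
  by case: (v \in A); rewrite ?mul1r ?mul0r.
by case: (v \in A); rewrite ?mul1r ?mul0r.
Qed.

Lemma connected_conn : connected G -> conn (@adj G) setT.
Proof.
move=> /andP[/card_gt0P[x0 _] /forallP cG]; apply/connP; split.
  by apply/set0Pn; exists x0; rewrite inE.
move=> X [/set0Pn[x xX] /properP[_ [y _ yX]] nX].
have clX : closed (@adj G) (mem X).
  move=> a b ab; have [aX|aX] := boolP (a \in X); have [bX|bX] := boolP (b \in X) => //.
    by have := nX a b aX; rewrite inE bX inE /nonadj /= ab => /(_ isT).
  by have := nX b a bX; rewrite inE aX inE /nonadj /= adj_sym ab => /(_ isT).
have /forallP/(_ y) xy := cG x; have := closed_connect clX xy.
by rewrite xX (negPf yX).
Qed.

Lemma local_mean_gt (v : G) : connected G -> cograph G -> (1 < #|G|)%N ->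
  global_mean G < local_mean v.
Proof.
move=> /connected_conn cG /cograph_p4_free P4 G1.
rewrite -cardsT in G1; have vT := in_setT v.
have := conn_at_mean (@adj_sym G) G1 P4 cG vT.
have S0 : [set: G] :\ v != set0.
  by rewrite -card_gt0 -ltnS; move: G1; rewrite (cardsD1 v) vT add1n.
have P4' : p4_free (@adj G) (nonadj (@adj G)) ([set: G] :\ v).
  by move=> a b c d _; apply: P4; rewrite !in_setT.
have := conn_card_bound (@adj_sym G) S0 P4'.
have cE : #|[set: G]| = #|[set: G] :\ v|.+1 by rewrite (cardsD1 v) vT.
rewrite global_meanE local_meanE.
have E1 := subset_sum_at (conn (@adj G)) (fun=> 1) vT.
have EM := subset_sum_at (conn (@adj G)) (fun A => #|A|%:R) vT.
have nv_gt0 : 0 < subset_sum (conn (@adj G)) (fun A => (v \in A)%:R * 1) setT.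
  rewrite /subset_sum (bigD1 [set v]) /= ?subsetT ?conn_set1 // set11 mulr1.
  by apply: ltr_pwDl => //; apply: sumr_ge0 => A _; rewrite mulr1 ler0n.
have n_ge0 : 0 <= subset_sum (conn (@adj G)) (fun=> 1) ([set: G] :\ v).
  exact: sumr_ge0.
(* Both bounds now have the same constant, the order of G plus one, as the mediant inequality
   demands. *)
rewrite cE -[#|_ :\ v|.+1%:R]natr1 -addrA => lt_rest le_at.
have -> : subset_sum (conn (@adj G)) (fun A => #|A|%:R) setT =
    subset_sum (conn (@adj G)) (fun A => (v \in A)%:R * #|A|%:R) setT
    + subset_sum (conn (@adj G)) (fun A => #|A|%:R) ([set: G] :\ v).
  by rewrite EM subrK.
have -> : subset_sum (conn (@adj G)) (fun=> 1) setT =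
    subset_sum (conn (@adj G)) (fun A => (v \in A)%:R * 1) setT
    + subset_sum (conn (@adj G)) (fun=> 1) ([set: G] :\ v).
  by rewrite E1 subrK.
exact: mediant_lt nv_gt0 n_ge0 lt_rest le_at.
Qed.

End SGraphs.

Theorem corollary3p2 (G : sgraph) (v : G) :
  connected G -> cograph G ->
  global_mean G <= local_mean v /\
  (local_mean v = global_mean G <-> iso G (complete_graph 1)).
Proof.
move=> cG coG; have [G1|G1] := leqP #|G| 1.
  (* With a single vertex, every connected set contains [v] and the two means coincide. *)
  have Gv (x : G) : x = v by move/fintype_le1P: G1 => /(_ v x).
  have E : local_mean v = global_mean G.
    rewrite local_meanE global_meanE; congr (_ / _); apply: eq_bigr => A.
      by move=> /andP[_ /andP[/set0Pn[x xA] _]]; rewrite -(Gv x) xA mul1r.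
    by move=> /andP[_ /andP[/set0Pn[x xA] _]]; rewrite -(Gv x) xA mul1r.
  rewrite E lexx; split=> //; split=> // _.
  exists (fun=> ord0).
    by exists (fun=> v) => x; [exact/esym/Gv | rewrite [x]ord1].
  by move=> x y; rewrite (Gv x) (Gv y) !adj_irrefl.
have lt := local_mean_gt v cG coG G1; split; first exact: ltW.
split=> [E|[f f_bij _]]; first by rewrite E ltxx in lt.
by rewrite (bij_eq_card f_bij) card_ord in G1.
Qed.
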